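(* Let $V$ be a finite vocabulary, $\mathcal{P}$ the set of probability distributions on $V$, $(\mathcal{K}, P_{\mathcal{K}})$ a key space with a key distribution, and $F:\mathcal{P}\times\mathcal{K}\to\mathcal{P}$ a watermarking function. For $\lambda\in[0,1]$ define $F_\lambda(P,k)=\lambda F(P,k)+(1-\lambda)P$. If $F$ is distortion-free, then for any $\lambda\in[0,1]$, $F_\lambda$ is also distortion-free; that is, for every $P\in\mathcal{P}$ and every token $x\in V$, $$\mathbb{E}_{k\sim P_{\mathcal{K}}}\big[F_\lambda(P,k)(x)\big]=P(x).$$
   Context: $V$ is a finite nonempty set (the vocabulary), and $\mathcal{P}$ is the space of probability distributions over $V$. A language model's next-token distribution given a prefix is an element $P$ of $\mathcal{P}$. $\mathcal{K}$ is a key space equipped with a probability distribution $P_{\mathcal{K}}$. A watermarking function is a map $F:\mathcal{P}\times\mathcal{K}\to\mathcal{P}$; write $F(P,k)(x)$ for the probability that $F(P,k)$ assigns to $x\in V$. For each $P$ the map $k\mapsto F(P,k)$ is measurable. $F$ is distortion-free if for every $P\in\mathcal{P}$ and every $x\in V$, $\mathbb{E}_{k\sim P_{\mathcal{K}}}[F(P,k)(x)]=P(x)$. *)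

(* Defs.v *)
From HB Require Import structures.
From mathcomp Require Import all_boot all_order all_algebra.
From mathcomp Require Import all_classical all_reals all_analysis.
From mathcomp Require Import measurable_realfun.

Set Implicit Arguments.
Unset Strict Implicit.
Unset Printing Implicit Defensive.

Import Order.TTheory GRing.Theory Num.Theory.

Local Open Scope classical_set_scope.
Local Open Scope ring_scope.

Record dist (R : realType) (V : finType) := Dist {
  dist_fun :> {ffun V -> R};
  dist_ge0 : forall x, 0 <= dist_fun x;
  dist_sum1 : \sum_x dist_fun x = 1
}.

(* The sigma-algebra generated by the evaluations P |-> P x; since V is finite,
   this is the trace of the Borel sets of R^V on the simplex.  It is not
   declared as a measurableType because these are pointed types, whereas
   [dist R V] is inhabited only when V is. *)
Definition dist_measurable (R : realType) (V : finType) :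
    set (set (dist R V)) :=
  <<s [set [set P : dist R V | B (P x)]
         | x in [set: V] & B in @measurable _ R] >>.

Record watermark (R : realType) (V : finType) d (K : measurableType d) :=
  Watermark {
    watermark_fun :> dist R V -> K -> dist R V;
    watermark_measurable : forall (P : dist R V) (A : set (dist R V)),
      dist_measurable A -> measurable (watermark_fun P @^-1` A)
  }.

Definition distortion_free (R : realType) (V : finType) d
    (K : measurableType d) (PK : probability K R) (F : watermark R V K) :=
  forall (P : dist R V) (x : V), ('E_PK[fun k => F P k x] = (P x)%:E)%E.

Section mixture.
Context (R : realType) (V : finType).
Implicit Types (l : {i01 R}) (P Q : dist R V).

Definition mix_fun l P Q : {ffun V -> R} :=
  [ffun x => l%:num * P x + (1 - l%:num) * Q x].

Lemma mix_ge0 l P Q x : 0 <= mix_fun l P Q x.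
Proof.
by rewrite ffunE addr_ge0 ?mulr_ge0 ?dist_ge0 // subr_ge0.
Qed.

Lemma mix_sum1 l P Q : \sum_x mix_fun l P Q x = 1.
Proof.
under eq_bigr do rewrite ffunE.
by rewrite big_split /= -!mulr_sumr !dist_sum1 !mulr1 addrC subrK.
Qed.

Definition mix l P Q : dist R V := Dist (mix_ge0 l P Q) (mix_sum1 l P Q).

End mixture.

Section interpolation.
Context (R : realType) (V : finType) d (K : measurableType d).
Implicit Types (F : watermark R V K) (l : {i01 R}) (P : dist R V).

Lemma measurable_watermark_eval F P x :
  measurable_fun [set: K] (fun k => F P k x).
Proof.
move=> _ B mB; rewrite setTI.
have mA : dist_measurable [set Q : dist R V | B (Q x)].
  by apply: sub_sigma_algebra; exists x => //; exists B.
exact: (watermark_measurable F P mA).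
Qed.

Lemma interpolate_measurable F l P (A : set (dist R V)) :
  dist_measurable A -> measurable ((fun k => mix l (F P k) P) @^-1` A).
Proof.
set f := fun k => mix l (F P k) P.
suff : @dist_measurable R V `<=` [set A | measurable (f @^-1` A)] by exact.
apply: smallest_sub.
  split=> [|B mB|B mB] /=.
  - by rewrite preimage_set0; exact: measurable0.
  - by rewrite setTD preimage_setC; exact: measurableC.
  - by rewrite preimage_bigcup; apply: bigcup_measurable => n _; exact: mB.
move=> _ [x _ [B mB <-]] /=.
have mf : measurable_fun [set: K] (fun k => f k x).
  under eq_fun do rewrite ffunE.
  apply: measurable_funD; last exact: measurable_cst.
  by apply: measurable_funM; [exact: measurable_cst|
                              exact: measurable_watermark_eval].
by rewrite -[X in measurable X]setTI; exact: mf.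
Qed.

Definition interpolate F l : watermark R V K :=
  Watermark (interpolate_measurable F l).

End interpolation.

(* Main.v *)
Require Import Defs.
From mathcomp Require Import all_boot all_order all_algebra.
From mathcomp Require Import all_classical all_reals all_analysis.
From mathcomp Require Import measurable_realfun.

Import Order.TTheory GRing.Theory Num.Theory.

(** Expectation is linear and [P] does not depend on the key, so the mean of the mixture at [x] is
    [l] times the mean of [F P k x] plus [(1 - l) * P x]. Distortion-freeness of [F] turns the first
    mean into [P x], and the weights add up to 1. *)

Theorem theorem4p3 (R : realType) (V : finType) (V_gt0 : (0 < #|V|)%N)
    (d : measure_display) (K : measurableType d) (PK : probability K R)
    (F : watermark R V K) :
  distortion_free PK F ->
  forall lambda : {i01 R}, distortion_free PK (interpolate F lambda).
Proof.
(* [unlock] turns both expectations into integrals over [PK]. *)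
move=> dfF l P x; have := dfF P x; rewrite unlock => EF.
have l_ge0 : (0 <= l%:num :> R)%R by [].
have oneBl_ge0 : (0 <= 1 - l%:num :> R)%R by rewrite subr_ge0.
have mF := measurable_watermark_eval F P x.
(* Both summands are nonnegative, so linearity needs no integrability. *)
under eq_integral do rewrite /= ffunE EFinD EFinM.
rewrite ge0_integralD //=; first last.
- by move=> k _; rewrite lee_fin mulr_ge0 ?dist_ge0.
- by apply: emeasurable_funM => //; exact/measurable_EFinP.
- by move=> k _; rewrite mule_ge0 ?lee_fin ?dist_ge0.
rewrite ge0_integralZl_EFin //=; first last.
- exact/measurable_EFinP.
- by move=> k _; rewrite lee_fin dist_ge0.
(* The constant summand integrates to itself because [PK] has total mass 1. *)
rewrite EF integral_cst //= probability_setT mule1 -EFinM -EFinD.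
by rewrite -mulrDl addrC subrK mul1r.
Qed.
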